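(* $Ps$-Tychonoffness is a topological property: if $X$ is a $Ps$-Tychonoff topological space and $Z$ is a topological space homeomorphic to $X$, then $Z$ is $Ps$-Tychonoff.
   Context: A topological space is pseudocompact if every real-valued continuous function on it is bounded; a subset is called pseudocompact if it is pseudocompact in the subspace topology. Tychonoff means completely regular and $T_1$. A space $X$ is $Ps$-Tychonoff if there exist a Tychonoff space $Y$ and a bijection $f:X\to Y$ such that $f|_K:K\to f(K)$ is a homeomorphism (subspace topologies) for every pseudocompact subset $K$ of $X$. *)

(* Defs.v *)
From HB Require Import structures.
From mathcomp Require Import all_boot all_order all_algebra.
From mathcomp Require Import all_classical all_reals all_analysis.

Set Implicit Arguments.
Unset Strict Implicit.
Unset Printing Implicit Defensive.

Import numFieldNormedType.Exports.
Local Open Scope classical_set_scope.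
Local Open Scope ring_scope.

Definition homeomorphism (X Y : topologicalType) (f : X -> Y) : Prop :=
  continuous f /\
  exists g : Y -> X, [/\ continuous g, cancel f g & cancel g f].

Definition homeomorphic (X Y : topologicalType) : Prop :=
  exists f : X -> Y, homeomorphism f.

Definition pseudocompact (R : realType) (X : topologicalType) : Prop :=
  forall f : X -> R, continuous f -> bounded_fun f.

(* [set_type K] carries the topology induced by the inclusion of K in X; the
   library's [subspace K] is instead a topology on all of X in which the points
   outside K are isolated. *)
Definition pseudocompact_set (R : realType) (X : topologicalType) (K : set X)
  : Prop := pseudocompact R (set_type K).

(* [completely_regular_space] is phrased with uniformities; by
   [uniform_separatorP] it amounts to separating points from closed sets by
   continuous functions to [0, 1]. It does not include T1. *)
Definition tychonoff (X : topologicalType) : Prop :=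
  completely_regular_space X /\ accessible_space X.

Definition restrict_to_image (X Y : Type) (f : X -> Y) (K : set X)
    (x : set_type K) : set_type (f @` K) :=
  SigSub (mem_set (imageP f (set_valP x))).

Definition ps_tychonoff (R : realType) (X : topologicalType) : Prop :=
  exists Y : topologicalType, tychonoff Y /\
  exists f : X -> Y, bijective f /\
  forall K : set X, pseudocompact_set R K ->
    homeomorphism (restrict_to_image f (K := K)).

(* Main.v *)
Require Import Defs.
From mathcomp Require Import all_boot all_order all_algebra.
From mathcomp Require Import all_classical all_reals all_analysis.

Import numFieldNormedType.Exports.
Local Open Scope classical_set_scope.

(** The Tychonoff space [Y] and bijection [f] witnessing the property for [X] serve for [Z] after
    precomposing with a homeomorphism [h] from [Z] to [X]. If K in [Z] is pseudocompact, [h]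
    restricts to a homeomorphism from K onto h(K) ([homeomorphism_restrict]), so h(K) is
    pseudocompact ([pseudocompact_homeomorphism]). Hence [f] is a homeomorphism on h(K), and the two
    restrictions compose ([homeomorphism_restrict_comp]). *)

Lemma continuous_set_val (X : topologicalType) (A : set X) :
  continuous (fun x : set_type A => \val x).
Proof. exact: initial_continuous. Qed.

Lemma continuous_to_set_type (X Y : topologicalType) (A : set Y)
    (f : X -> set_type A) :
  continuous (fun x => \val (f x)) -> continuous f.
Proof. by move=> cf; apply: continuous_comp_initial. Qed.

Lemma homeomorphism_comp {X Y Z : topologicalType} {f : X -> Y} {g : Y -> Z} :
  homeomorphism f -> homeomorphism g -> homeomorphism (g \o f).
Proof.
move=> [cf [f' [cf' fK f'K]]] [cg [g' [cg' gK g'K]]]; split.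
  by move=> x; apply: continuous_comp; [exact: cf | exact: cg].
exists (f' \o g'); split; [|exact: can_comp|exact: can_comp].
by move=> x; apply: continuous_comp; [exact: cg' | exact: cf'].
Qed.

Lemma homeomorphism_restrict {X Y : topologicalType} {f : X -> Y} (K : set X) :
  homeomorphism f -> homeomorphism (restrict_to_image f (K := K)).
Proof.
move=> [cf [g [cg fK gK]]]; split.
  apply: continuous_to_set_type => x.
  by apply: (@continuous_comp _ _ _ _ f); [exact: continuous_set_val|exact: cf].
have gP (y : set_type (f @` K)) : g (\val y) \in K.
  by apply/mem_set; have [x Kx <-] := set_valP y; rewrite fK.
exists (fun y => SigSub (gP y)); split.
- apply: continuous_to_set_type => y.
  by apply: (@continuous_comp _ _ _ _ g); [exact: continuous_set_val|exact: cg].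
- by move=> x; apply: val_inj; exact: fK.
- by move=> y; apply: val_inj; exact: gK.
Qed.

(** Propositionally equal sets need not have convertible [set_type]s. Once the equality is
    eliminated, a map that keeps underlying points is the identity. *)
Lemma homeomorphism_set_type_cast (X : topologicalType) (A B : set X)
    (c : set_type A -> set_type B) :
  A = B -> (forall x, \val (c x) = \val x) -> homeomorphism c.
Proof.
move=> AB; case: _ / AB c => c cE.
have -> : c = id by apply/funext => x; exact: val_inj.
by split; [|exists id; split] => // x; exact: cvg_id.
Qed.

Lemma homeomorphism_restrict_comp (X Y Z : topologicalType) (f : X -> Y)
    (g : Y -> Z) (K : set X) :
  homeomorphism (restrict_to_image f (K := K)) ->
  homeomorphism (restrict_to_image g (K := f @` K)) ->
  homeomorphism (restrict_to_image (g \o f) (K := K)).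
Proof.
(* The composed restrictions land in the iterated image g(f(K)), a different type from the image of
   K under [g \o f]; a cast along [E] bridges the two. *)
move=> hf hg; have E : g @` (f @` K) = (g \o f) @` K by rewrite image_comp.
have cP (z : set_type (g @` (f @` K))) : \val z \in (g \o f) @` K.
  by rewrite -E; exact: valP.
have hc : homeomorphism (fun z => SigSub (cP z) : set_type ((g \o f) @` K)).
  exact: homeomorphism_set_type_cast.
have := homeomorphism_comp (homeomorphism_comp hf hg) hc.
by congr homeomorphism; apply/funext => x; exact: val_inj.
Qed.

Lemma pseudocompact_homeomorphism {R : realType} {X Y : topologicalType}
    {f : X -> Y} :
  homeomorphism f -> pseudocompact R X -> pseudocompact R Y.
Proof.
move=> [cf [g [_ _ gK]]] pX u cu.
have /pX : continuous (u \o f).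
  by move=> x; apply: continuous_comp; [exact: cf | exact: cu].
(* Boundedness says that all large enough [M] are bounds. Each bound of [u \o f] also bounds [u],
   since every [y] is [f (g y)]. *)
apply: (filterS (P := fun M : R => _)) => M uM y _ /=.
by rewrite -(gK y); exact: uM.
Qed.

Theorem theorem3p6 (R : realType) (X Z : topologicalType)
  (hX : ps_tychonoff R X) (hZX : homeomorphic Z X) : ps_tychonoff R Z.
Proof.
have [Y [tY [f [bf fK]]]] := hX; have [h hh] := hZX.
exists Y; split=> //; exists (f \o h); split.
  by apply: bij_comp => //; have [_ [g [_ ? ?]]] := hh; exists g.
move=> K pK; have hK := homeomorphism_restrict K hh.
apply: homeomorphism_restrict_comp (hK) _; apply: fK.
exact: pseudocompact_homeomorphism hK pK.
Qed.
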